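(* Let $U\subset\mathbb R^n$ be open, $X$ a $C^1$ vector field on $U$, $f=(f_0,f_1,\dots,f_\ell):U\to\mathbb R^{r+\ell}$ a $C^2$ map, $x_0\in U$, $K$ a constant symmetric positive definite $(r+\ell)\times(r+\ell)$ matrix, and $V(x)=\tfrac12(f(x)-f(x_0))^TK(f(x)-f(x_0))$. Assume $\nabla V(x)\cdot X(x)=0$ for all $x\in U$, $V^{-1}(0)$ is compact, and there is an open set $W\subset U$ containing $V^{-1}(0)$ such that $Df(x)$ is onto for all $x\in W\setminus V^{-1}(0)$. Then there is a number $c>0$ (restricting the system, if necessary, to an open neighborhood of $V^{-1}(0)$ contained in $W$) such that every trajectory of $\dot x = X(x)-\nabla V(x)$ starting in $V^{-1}([0,c])$ remains in $V^{-1}([0,c])$ for all $t\ge0$ and converges to $V^{-1}(0)$ as $t\to\infty$. *)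

(* Defs.v *)
From mathcomp Require Import all_boot.
From Stdlib Require Import Reals List.
Open Scope R_scope.

Definition vec (n : nat) := 'I_n -> R.
Definition mat (m n : nat) := 'I_m -> 'I_n -> R.

Definition rsum (n : nat) (F : 'I_n -> R) : R := \big[Rplus/R0]_(i < n) F i.

Definition vadd {n} (u v : vec n) : vec n := fun i => u i + v i.
Definition vsub {n} (u v : vec n) : vec n := fun i => u i - v i.
Definition dot {n} (u v : vec n) : R := rsum n (fun i => u i * v i).
Definition norm {n} (u : vec n) : R := sqrt (dot u u).
Definition mulmv {m n} (A : mat m n) (v : vec n) : vec m :=
  fun i => rsum n (fun j => A i j * v j).

Definition is_open {n} (U : vec n -> Prop) : Prop :=
  forall x, U x -> exists eps, 0 < eps /\
    forall y, norm (vsub y x) < eps -> U y.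

Definition is_compact {n} (S : vec n -> Prop) : Prop :=
  forall (I : Type) (O : I -> vec n -> Prop),
    (forall i, is_open (O i)) ->
    (forall x, S x -> exists i, O i x) ->
    exists l : list I, forall x, S x -> exists i, In i l /\ O i x.

Definition continuous_on {n} (U : vec n -> Prop) (g : vec n -> R) : Prop :=
  forall x, U x -> forall eps, 0 < eps -> exists delta, 0 < delta /\
    forall y, U y -> norm (vsub y x) < delta -> Rabs (g y - g x) < eps.

Definition is_deriv {n m} (F : vec n -> vec m) (x : vec n) (D : mat m n) : Prop :=
  forall eps, 0 < eps -> exists delta, 0 < delta /\
    forall h : vec n, norm h < delta ->
      norm (vsub (vsub (F (vadd x h)) (F x)) (mulmv D h)) <= eps * norm h.

Definition is_grad {n} (g : vec n -> R) (x : vec n) (G : vec n) : Prop :=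
  forall eps, 0 < eps -> exists delta, 0 < delta /\
    forall h : vec n, norm h < delta ->
      Rabs (g (vadd x h) - g x - dot G h) <= eps * norm h.

Definition C1_on {n m} (U : vec n -> Prop) (F : vec n -> vec m) : Prop :=
  exists DF : vec n -> mat m n,
    (forall x, U x -> is_deriv F x (DF x)) /\
    (forall i j, continuous_on U (fun x => DF x i j)).

Definition C2_on {n m} (U : vec n -> Prop) (F : vec n -> vec m) : Prop :=
  exists DF : vec n -> mat m n,
    (forall x, U x -> is_deriv F x (DF x)) /\
    (forall i, C1_on U (fun x => (fun j => DF x i j) : vec n)).

Definition onto {m n} (A : mat m n) : Prop :=
  forall w : vec m, exists v : vec n, forall i, mulmv A v i = w i.

Definition sym_mat {m} (K : mat m m) : Prop := forall i j, K i j = K j i.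
Definition qform {m} (K : mat m m) (v : vec m) : R := dot v (mulmv K v).
Definition pos_def {m} (K : mat m m) : Prop :=
  forall v : vec m, (exists i, v i <> 0) -> 0 < qform K v.

Definition Vfun {n m} (K : mat m m) (f : vec n -> vec m) (x0 : vec n) (x : vec n) : R :=
  / 2 * qform K (vsub (f x) (f x0)).

Definition solution_on {n} (D : vec n -> Prop) (Y : vec n -> vec n)
    (phi : R -> vec n) (T : R) : Prop :=
  (forall t, 0 <= t < T -> D (phi t)) /\
  (forall t, 0 < t < T -> forall i,
      derivable_pt_lim (fun s => phi s i) t (Y (phi t) i)) /\
  (forall eps, 0 < eps -> exists delta, 0 < delta /\
      forall s, 0 <= s < delta -> norm (vsub (phi s) (phi 0)) < eps).

Definition converges_to_set {n} (phi : R -> vec n) (S : vec n -> Prop) : Prop :=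
  forall eps, 0 < eps -> exists T, forall t, T <= t ->
    exists z, S z /\ norm (vsub (phi t) z) < eps.

(* Main.v *)
From mathcomp Require Import all_boot zify.
From Stdlib Require Import Reals Lra Lia Classical ClassicalEpsilon FunctionalExtensionality.
From Coquelicot Require Import Coquelicot.
Require Import Defs.
Open Scope R_scope.

(** Let [S = V^{-1}(0)] and let [N] be a closed tubular neighbourhood of [S] inside [W], with
    interior tube [U'].  By compactness, points of [N] with [V] small enough lie in [U'], so
    [{x in U' | V x <= c}] is compact.  Along the flow [V' = - |grad V|^2 <= 0], hence this set is
    positively invariant.  Since [X - grad V] is locally Lipschitz, it is Lipschitz on [N]; its
    McShane extension to [R^n] has global solutions by Picard iteration, and these never leave
    the invariant set, where the extension agrees with the original field.  Finally
    [grad V = Df^T K (f - f x0)] with [Df] onto vanishes on [N] only at points of [S], so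
    [|grad V|^2] is bounded below where [V >= eta]; hence [V] tends to [0] along trajectories,
    and by compactness they approach [S]. *)

(** * Finite sums of reals indexed by ordinals *)

(** A list-recursive form of the sum: proofs rewrite to it and then go by induction on an arbitrary
    list in place of the enumeration of ['I_n]. *)
Fixpoint lsum {n : nat} (s : seq 'I_n) (F : 'I_n -> R) : R :=
  if s is i :: s' then F i + lsum s' F else 0.

Lemma rsumE n (F : 'I_n -> R) : rsum n F = lsum (enum 'I_n) F.
Proof.
rewrite /rsum [index_enum _]unlock -enumT; elim: (enum _) => [|i s IH];
  rewrite ?big_nil ?big_cons //.
by rewrite IH.
Qed.

Section FiniteSums.
Variable n : nat.
Implicit Types F G : 'I_n -> R.

Lemma rsum_ext F G : (forall i, F i = G i) -> rsum n F = rsum n G.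
Proof. by move=> h; apply: eq_bigr => i _. Qed.

Lemma rsum_add F G : rsum n (fun i => F i + G i) = rsum n F + rsum n G.
Proof. by rewrite !rsumE; elim: (enum _) => [|i s IH] /=; lra. Qed.

Lemma rsum_scal c F : rsum n (fun i => c * F i) = c * rsum n F.
Proof. by rewrite !rsumE; elim: (enum _) => [|i s IH] /=; lra. Qed.

Lemma rsum_le F G : (forall i, F i <= G i) -> rsum n F <= rsum n G.
Proof.
by move=> h; rewrite !rsumE; elim: (enum _) => [|i s IH] /=; [|have := h i]; lra.
Qed.

Lemma rsum_zero : rsum n (fun _ => 0) = 0.
Proof. by rewrite rsumE; elim: (enum _) => [|i s IH] /=; lra. Qed.

Lemma rsum_const c : rsum n (fun _ => c) = INR n * c.
Proof.
rewrite rsumE -[in RHS](size_enum_ord n).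
elim: (enum _) => [|i s IH]; first by rewrite /=; lra.
by rewrite -[lsum _ _]/(c + lsum s (fun=> c)) -[size _]/(size s).+1 S_INR IH; ring.
Qed.

Lemma rsum_ge0 F : (forall i, 0 <= F i) -> 0 <= rsum n F.
Proof. by move=> h; rewrite -rsum_zero; apply: rsum_le. Qed.

Lemma rsum_ge_term F i : (forall j, 0 <= F j) -> F i <= rsum n F.
Proof.
move=> h; rewrite rsumE; have := mem_enum 'I_n i; rewrite inE => hi.
elim: (enum _) hi => [//|j s IH] /=; rewrite inE => /orP[/eqP <-|/IH hs].
  have: 0 <= lsum s F; last by lra.
  by elim: s {IH} => [|k s IH] /=; [|have := h k]; lra.
by have := h j; lra.
Qed.

Lemma rsum_delta F i : rsum n (fun j => F j * (if j == i then 1 else 0)) = F i.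
Proof.
rewrite rsumE; have := mem_enum 'I_n i; rewrite inE => hi; have := enum_uniq 'I_n.
elim: (enum _) hi => [//|j s IH] /=; rewrite inE => /orP[/eqP ->|hs] /andP[js us].
  suff -> : lsum s (fun k => F k * (if k == j then 1 else 0)) = 0 by rewrite eqxx; lra.
  elim: s js {IH us} => [//|k s IH] /=; rewrite inE negb_or => /andP[jk ks].
  by rewrite IH // eq_sym (negbTE jk); lra.
have -> : (j == i) = false by apply/eqP => ji; move: js; rewrite ji hs.
by rewrite IH //; lra.
Qed.

Lemma derivable_pt_lim_rsum (F : 'I_n -> R -> R) (D : 'I_n -> R) t :
  (forall i, derivable_pt_lim (F i) t (D i)) ->
  derivable_pt_lim (fun s => rsum n (fun i => F i s)) t (rsum n D).
Proof.
move=> h; apply: (derivable_pt_lim_ext (fun x => lsum (enum 'I_n) (fun i => F i x))).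
  by move=> x; rewrite rsumE.
rewrite rsumE; elim: (enum _) => [|i s IH] /=; first exact: derivable_pt_lim_const.
exact: (derivable_pt_lim_plus (F i)).
Qed.

Lemma continuity_pt_rsum (F : 'I_n -> R -> R) t :
  (forall i, continuity_pt (F i) t) ->
  continuity_pt (fun s => rsum n (fun i => F i s)) t.
Proof.
move=> h; apply: (continuity_pt_ext (fun x => lsum (enum 'I_n) (fun i => F i x))).
  by move=> x; rewrite rsumE.
elim: (enum _) => [|i s IH] /=; first exact: continuity_pt_const.
exact: (continuity_pt_plus (F i)).
Qed.

(** The minimum of finitely many positive radii is positive, and monotonicity lets each property
    survive the shrinking. This yields one radius valid for all coordinates. *)
Lemma uniform_pos (P : 'I_n -> R -> Prop) :
  (forall i d d', 0 < d' <= d -> P i d -> P i d') ->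
  (forall i, exists d, 0 < d /\ P i d) -> exists d, 0 < d /\ forall i, P i d.
Proof.
move=> mono h.
suff [d [d0 hd]] : exists d, 0 < d /\ forall i, i \in enum 'I_n -> P i d.
  by exists d; split=> // i; apply: hd; rewrite mem_enum.
elim: (enum _) => [|i s [d [d0 hd]]]; first by exists 1; split; [lra|].
case: (h i) => d' [d'0 hd'].
have m0 := Rmin_glb_lt _ _ _ d0 d'0.
have m1 := Rmin_r d d'; have m2 := Rmin_l d d'.
exists (Rmin d d'); split=> // j; rewrite inE => /orP[/eqP ->|/hd]; last by apply: mono.
by apply: mono hd'.
Qed.

End FiniteSums.

Lemma rsum_exchange m n (F : 'I_m -> 'I_n -> R) :
  rsum m (fun i => rsum n (fun j => F i j)) = rsum n (fun j => rsum m (fun i => F i j)).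
Proof.
rewrite rsumE [RHS](rsum_ext _ _ _ (fun j => rsumE _ _)).
elim: (enum 'I_m) => [|i s IH] /=; first by rewrite rsum_zero.
by rewrite IH -rsum_add.
Qed.

(** * Euclidean inner product and norm *)

Section Euclidean.
Variable n : nat.
Implicit Types u v w x y z : vec n.

Definition vscal c v : vec n := fun i => c * v i.

Lemma dotC u v : dot u v = dot v u.
Proof. by apply: rsum_ext => i; lra. Qed.

Lemma dot_addl u v w : dot (vadd u v) w = dot u w + dot v w.
Proof. by rewrite -rsum_add; apply: rsum_ext => i; rewrite /vadd; lra. Qed.

Lemma dot_scall c u w : dot (vscal c u) w = c * dot u w.
Proof. by rewrite -rsum_scal; apply: rsum_ext => i; rewrite /vscal; lra. Qed.

Lemma dot_subl u v w : dot (vsub u v) w = dot u w - dot v w.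
Proof.
have -> : vsub u v = vadd u (vscal (-1) v).
  by apply: functional_extensionality => i; rewrite /vsub /vadd /vscal; lra.
by rewrite dot_addl dot_scall; lra.
Qed.

Lemma dot_ge0 u : 0 <= dot u u.
Proof. by apply: rsum_ge0 => i; nra. Qed.

Lemma norm_ge0 u : 0 <= norm u.
Proof. exact: sqrt_pos. Qed.

Lemma norm_sqr u : norm u * norm u = dot u u.
Proof. exact/sqrt_sqrt/dot_ge0. Qed.

(** The quadratic [t -> |u - t v|^2] is nonnegative, so its discriminant is nonpositive. *)
Lemma Cauchy_Schwarz u v : Rabs (dot u v) <= norm u * norm v.
Proof.
have quad t : 0 <= dot u u - 2 * t * dot u v + t * t * dot v v.
  have := dot_ge0 (vsub u (vscal t v)).
  by rewrite dot_subl dot_scall !(dotC _ (vsub _ _)) !dot_subl !dot_scall (dotC v u); lra.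
have disc : dot u v * dot u v <= dot u u * dot v v.
  case: (dot_ge0 v) => [v0|v0]; last first.
    (* With [|v| = 0] the quadratic is affine in [t]; the value of [t] used next would make it equal
       to [-1]. *)
    case: (Req_dec (dot u v) 0) => [->|b0]; first by have := dot_ge0 u; nra.
    have := quad ((dot u u + 1) / (2 * dot u v)); rewrite -v0.
    have -> : 2 * ((dot u u + 1) / (2 * dot u v)) * dot u v = dot u u + 1 by field.
    by lra.
  (* The minimiser of the quadratic. *)
  have := quad (dot u v / dot v v).
  have -> : dot u u - 2 * (dot u v / dot v v) * dot u v
            + dot u v / dot v v * (dot u v / dot v v) * dot v v
          = (dot u u * dot v v - dot u v * dot u v) / dot v v by field; lra.
  move=> h; have := Rmult_le_pos _ _ h (Rlt_le _ _ v0).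
  by rewrite /Rdiv Rmult_assoc Rinv_l; lra.
apply: Rsqr_incr_0_var; last by apply: Rmult_le_pos; exact: norm_ge0.
rewrite -Rsqr_abs /Rsqr.
have -> : norm u * norm v * (norm u * norm v) = (norm u * norm u) * (norm v * norm v) by ring.
by rewrite !norm_sqr.
Qed.

Lemma norm_triangle u v : norm (vadd u v) <= norm u + norm v.
Proof.
apply: Rsqr_incr_0_var; last by have := norm_ge0 u; have := norm_ge0 v; lra.
rewrite /Rsqr norm_sqr dot_addl !(dotC _ (vadd _ _)) !dot_addl (dotC v u).
have := Cauchy_Schwarz u v; have := Rle_abs (dot u v).
by have := norm_sqr u; have := norm_sqr v; lra.
Qed.

Lemma norm_vscal c u : norm (vscal c u) = Rabs c * norm u.
Proof.
rewrite /norm dot_scall dotC dot_scall -Rmult_assoc sqrt_mult_alt; last by nra.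
by rewrite -/(Rsqr c) sqrt_Rsqr_abs.
Qed.

Lemma norm_vsubC u v : norm (vsub u v) = norm (vsub v u).
Proof. by rewrite /norm; congr sqrt; apply: rsum_ext => i; rewrite /vsub; lra. Qed.

Lemma norm_vsub_triangle u v w : norm (vsub u w) <= norm (vsub u v) + norm (vsub v w).
Proof.
have -> : vsub u w = vadd (vsub u v) (vsub v w).
  by apply: functional_extensionality => i; rewrite /vsub /vadd; lra.
exact: norm_triangle.
Qed.

Lemma norm_vsubxx u : norm (vsub u u) = 0.
Proof.
rewrite /norm -sqrt_0; congr sqrt; rewrite -(rsum_zero n).
by apply: rsum_ext => i; rewrite /vsub; lra.
Qed.

Lemma Rabs_coord_le u i : Rabs (u i) <= norm u.
Proof.
apply: Rsqr_incr_0_var; last exact: norm_ge0.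
rewrite -Rsqr_abs /Rsqr norm_sqr.
by apply: (rsum_ge_term _ (fun j => u j * u j)) => j; nra.
Qed.

Lemma norm_le_l1 u : norm u <= rsum n (fun i => Rabs (u i)).
Proof.
have s0 : 0 <= rsum n (fun i => Rabs (u i)) by apply: rsum_ge0 => i; exact: Rabs_pos.
apply: Rsqr_incr_0_var => //; rewrite /Rsqr norm_sqr -rsum_scal.
apply: rsum_le => i.
have -> : u i * u i = Rabs (u i) * Rabs (u i) by rewrite -Rabs_mult Rabs_pos_eq //; nra.
apply: Rmult_le_compat_r; first exact: Rabs_pos.
by apply: (rsum_ge_term _ (fun j => Rabs (u j))) => j; exact: Rabs_pos.
Qed.

Lemma norm_le_bound u c : (forall i, Rabs (u i) <= c) -> norm u <= INR n * c.
Proof.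
by move=> h; rewrite -rsum_const; apply: Rle_trans (norm_le_l1 u) _; apply: rsum_le.
Qed.

(** The sum of the [|w s j - w t j|] is continuous in [s], vanishes at [s = t] and dominates the
    norm. *)
Lemma curve_continuous (w : R -> vec n) t : (forall j, continuity_pt (fun s => w s j) t) ->
  forall eps, 0 < eps -> exists d, 0 < d /\
    forall s, Rabs (s - t) < d -> norm (vsub (w s) (w t)) < eps.
Proof.
move=> cw eps eps0.
have cs : continuity_pt (fun s => rsum n (fun j => Rabs (w s j - w t j))) t.
  apply: continuity_pt_rsum => j.
  apply: (continuity_pt_comp (fun s => w s j - w t j)); last exact: Rcontinuity_abs.
  by apply: continuity_pt_minus; [exact: cw|exact: continuity_pt_const].
have [d [d0 hd]] := cs eps eps0; exists d; split=> // s hs.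
case: (Req_dec t s) => [<-|ne]; first by rewrite norm_vsubxx.
have := hd s (conj (conj Logic.I ne) hs); rewrite /= /Rdist.
have -> : rsum n (fun j => Rabs (w t j - w t j)) = 0.
  by rewrite -(rsum_zero n); apply: rsum_ext => j; rewrite Rminus_eq_0 Rabs_R0.
rewrite Rminus_0_r => h1.
exact: Rle_lt_trans (norm_le_l1 _) (Rle_lt_trans _ _ _ (Rle_abs _) h1).
Qed.

Lemma vaddK x y : vadd x (vsub y x) = y.
Proof. by apply: functional_extensionality => i; rewrite /vadd /vsub; lra. Qed.

End Euclidean.

(** * The chain rule along a curve *)

(** The increment of [g] along the curve is its linear part plus a remainder. The linear part has
    the right difference quotient, and the remainder is small compared with [h] because the curve
    moves by at most [M * Rabs h]. *)
Lemma is_grad_comp_curve n (g : vec n -> R) (G : vec n) (phi : R -> vec n) (v : vec n) t :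
  is_grad g (phi t) G -> (forall i, derivable_pt_lim (fun s => phi s i) t (v i)) ->
  derivable_pt_lim (fun s => g (phi s)) t (dot G v).
Proof.
move=> hg hphi eps eps0.
(* Near [t] each difference quotient is within [1] of [v i], so [M] bounds the speed of the curve in
   the l1 norm. *)
pose M := rsum n (fun i => Rabs (v i) + 1).
have M0 : 0 <= M by apply: rsum_ge0 => i; have := Rabs_pos (v i); lra.
have [d1 [d10 hd1]] : exists d, 0 < d /\ forall i h, h <> 0 -> Rabs h < d ->
    Rabs ((phi (t + h) i - phi t i) / h - v i) < 1.
  apply: (uniform_pos _ (fun i d => forall h, h <> 0 -> Rabs h < d ->
    Rabs ((phi (t + h) i - phi t i) / h - v i) < 1)).
    by move=> i d d' dd' H h h0 hd; apply: H => //; lra.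
  by move=> i; case: (hphi i 1 Rlt_0_1) => d hd; exists d; split; [exact: cond_pos|].
have incr h : h <> 0 -> Rabs h < d1 -> norm (vsub (phi (t + h)) (phi t)) <= M * Rabs h.
  move=> h0 hd; apply: Rle_trans (norm_le_l1 _ _) _.
  rewrite Rmult_comm -rsum_scal; apply: rsum_le => i.
  have := hd1 i h h0 hd; set q := _ / h => hq.
  have -> : vsub (phi (t + h)) (phi t) i = h * q by rewrite /vsub /q; field.
  rewrite Rabs_mult; apply: Rmult_le_compat_l; first exact: Rabs_pos.
  have := Rabs_triang (q - v i) (v i); have -> : q - v i + v i = q by ring.
  by lra.
(* With this tolerance the remainder costs at most [eps / 2] per unit of [h]; [M + 1] keeps the
   denominator positive. *)
have e0 : 0 < eps / 2 / (M + 1) by apply: Rdiv_lt_0_compat; lra.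
case: (hg _ e0) => d2 [d20 hd2].
have hlin : derivable_pt_lim (fun s => dot G (phi s)) t (dot G v).
  by apply: derivable_pt_lim_rsum => i; apply: (derivable_pt_lim_scal (fun s => phi s i)).
case: (hlin (eps / 2)) => [|d3 hd3]; first by lra.
have d4 : 0 < d2 / (M + 1) by apply: Rdiv_lt_0_compat; lra.
have dpos : 0 < Rmin d1 (Rmin (d2 / (M + 1)) d3).
  by apply: Rmin_glb_lt => //; apply: Rmin_glb_lt => //; exact: cond_pos.
exists (mkposreal _ dpos) => h h0 /= hd.
have hd' : Rabs h < d1 by apply: Rlt_le_trans hd (Rmin_l _ _).
have hd'' : Rabs h < d2 / (M + 1).
  by apply: Rlt_le_trans hd _; apply: Rle_trans (Rmin_r _ _) (Rmin_l _ _).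
have hd''' : Rabs h < d3.
  by apply: Rlt_le_trans hd _; apply: Rle_trans (Rmin_r _ _) (Rmin_r _ _).
have hn := incr h h0 hd'.
have h1 : norm (vsub (phi (t + h)) (phi t)) < d2.
  have := Rmult_lt_compat_l (M + 1) _ _ ltac:(lra) hd''.
  have -> : (M + 1) * (d2 / (M + 1)) = d2 by field; lra.
  by have := Rabs_pos h; lra.
have := hd2 _ h1; rewrite vaddK => h2.
have := hd3 h h0 hd'''.
have -> : dot G (phi (t + h)) - dot G (phi t) = dot G (vsub (phi (t + h)) (phi t)).
  by rewrite !(dotC _ G) dot_subl.
set w := vsub _ _ in hn h1 h2 *; set gd := _ - g _ in h2 *; move=> h3.
have hp := Rabs_pos_lt h h0.
have h4 : Rabs ((gd - dot G w) / h) <= eps / 2.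
  rewrite /Rdiv Rabs_mult Rabs_inv -/(Rdiv _ _).
  apply/Rle_div_l => //; apply: Rle_trans h2 _.
  apply: Rle_trans (Rmult_le_compat_l _ _ _ (Rlt_le _ _ e0) hn) _.
  have -> : eps / 2 / (M + 1) * (M * Rabs h) = eps / 2 * Rabs h * (M / (M + 1)) by field; lra.
  rewrite -{2}(Rmult_1_r (eps / 2 * Rabs h)); apply: Rmult_le_compat_l; first by nra.
  by apply/Rle_div_l; lra.
have -> : gd / h - dot G v = (gd - dot G w) / h + (dot G w / h - dot G v) by field.
by have := Rabs_triang ((gd - dot G w) / h) (dot G w / h - dot G v); lra.
Qed.

Lemma is_deriv_coord n m (F : vec n -> vec m) x D i :
  is_deriv F x D -> is_grad (fun y => F y i) x (D i).
Proof.
move=> hF eps eps0; case: (hF eps eps0) => d [d0 hd]; exists d; split=> // h hh.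
exact: Rle_trans (Rabs_coord_le _ _ i) (hd h hh).
Qed.

(** * Locally Lipschitz functions *)

(** Both points vary in the ball, rather than one being fixed at [a]; this is what allows a single
    Lipschitz constant on a compact set. *)
Definition loc_lip {n} (g : vec n -> R) (a : vec n) : Prop :=
  exists rho L, 0 < rho /\ 0 <= L /\ forall x y,
    norm (vsub x a) < rho -> norm (vsub y a) < rho -> Rabs (g x - g y) <= L * norm (vsub x y).

Definition cont_at {n} (g : vec n -> R) (a : vec n) : Prop :=
  forall eps, 0 < eps -> exists d, 0 < d /\
    forall y, norm (vsub y a) < d -> Rabs (g y - g a) < eps.

Section LocallyLipschitz.
Variable n : nat.
Implicit Types (g : vec n -> R) (a : vec n).

Lemma loc_lip_cont g a : loc_lip g a -> cont_at g a.
Proof.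
move=> [rho [L [rho0 [L0 hL]]]] eps eps0.
have e0 : 0 < eps / (L + 1) by apply: Rdiv_lt_0_compat; lra.
exists (Rmin rho (eps / (L + 1))); split; first exact: Rmin_glb_lt.
move=> y hy.
have h1 : norm (vsub y a) < rho by apply: Rlt_le_trans hy (Rmin_l _ _).
have h2 : norm (vsub y a) < eps / (L + 1) by apply: Rlt_le_trans hy (Rmin_r _ _).
have := hL y a h1; rewrite norm_vsubxx => /(_ rho0) h3.
have := Rmult_lt_compat_l (L + 1) _ _ ltac:(lra) h2.
have -> : (L + 1) * (eps / (L + 1)) = eps by field; lra.
by have := norm_ge0 _ (vsub y a); lra.
Qed.

Lemma loc_lip_const (c : R) a : loc_lip (fun _ => c) a.
Proof.
exists 1, 0; split; [lra|split; [lra|]] => x y _ _.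
by rewrite Rminus_eq_0 Rabs_R0; lra.
Qed.

Lemma loc_lip_eq_near g g' a r : 0 < r ->
  (forall x, norm (vsub x a) < r -> g x = g' x) -> loc_lip g a -> loc_lip g' a.
Proof.
move=> r0 e [rho [L [rho0 [L0 hL]]]].
exists (Rmin r rho), L; split; [exact: Rmin_glb_lt|split=> //] => x y hx hy.
rewrite -!e; try by apply: Rlt_le_trans (Rmin_l r rho).
by apply: hL; apply: Rlt_le_trans (Rmin_r r rho).
Qed.

Lemma loc_lip_add g g' a : loc_lip g a -> loc_lip g' a -> loc_lip (fun x => g x + g' x) a.
Proof.
move=> [r [L [r0 [L0 hL]]]] [r' [L' [r'0 [L'0 hL']]]].
exists (Rmin r r'), (L + L'); split; [exact: Rmin_glb_lt|split; [lra|]] => x y hx hy.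
have h1 := hL x y (Rlt_le_trans _ _ _ hx (Rmin_l _ _)) (Rlt_le_trans _ _ _ hy (Rmin_l _ _)).
have h2 := hL' x y (Rlt_le_trans _ _ _ hx (Rmin_r _ _)) (Rlt_le_trans _ _ _ hy (Rmin_r _ _)).
have -> : g x + g' x - (g y + g' y) = (g x - g y) + (g' x - g' y) by ring.
by have := Rabs_triang (g x - g y) (g' x - g' y); lra.
Qed.

(** Near [a] each factor is bounded by its absolute value at [a] plus [1], and the difference of
    products splits as in the product rule. *)
Lemma loc_lip_mult g g' a : loc_lip g a -> loc_lip g' a -> loc_lip (fun x => g x * g' x) a.
Proof.
move=> hg hg'.
case: (loc_lip_cont _ _ hg 1 Rlt_0_1) => d [d0 hd].
case: (loc_lip_cont _ _ hg' 1 Rlt_0_1) => d' [d'0 hd'].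
case: hg => r [L [r0 [L0 hL]]]; case: hg' => r' [L' [r'0 [L'0 hL']]].
have A0 := Rabs_pos (g a); have A'0 := Rabs_pos (g' a).
exists (Rmin (Rmin r r') (Rmin d d')), (L * (Rabs (g' a) + 1) + L' * (Rabs (g a) + 1)).
split; [by do 2! apply: Rmin_glb_lt|split; [nra|]] => x y hx hy.
have hm z : norm (vsub z a) < Rmin (Rmin r r') (Rmin d d') ->
   norm (vsub z a) < r /\ norm (vsub z a) < r' /\ norm (vsub z a) < d /\ norm (vsub z a) < d'.
  have := Rmin_l (Rmin r r') (Rmin d d'); have := Rmin_r (Rmin r r') (Rmin d d').
  have := Rmin_l r r'; have := Rmin_r r r'; have := Rmin_l d d'; have := Rmin_r d d'.
  by lra.
case: (hm x hx) => x1 [x2 [x3 x4]]; case: (hm y hy) => y1 [y2 [y3 y4]].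
have h1 := hL x y x1 y1; have h2 := hL' x y x2 y2.
have b1 : Rabs (g y) <= Rabs (g a) + 1.
  by have := Rabs_triang (g y - g a) (g a); rewrite Rplus_comm Rplus_minus; have := hd y y3; lra.
have b2 : Rabs (g' x) <= Rabs (g' a) + 1.
  have := Rabs_triang (g' x - g' a) (g' a); rewrite Rplus_comm Rplus_minus.
  by have := hd' x x4; lra.
have -> : g x * g' x - g y * g' y = (g x - g y) * g' x + g y * (g' x - g' y) by ring.
apply: Rle_trans (Rabs_triang _ _) _; rewrite !Rabs_mult Rmult_plus_distr_r.
apply: Rplus_le_compat.
  have -> : L * (Rabs (g' a) + 1) * norm (vsub x y) =
      (L * norm (vsub x y)) * (Rabs (g' a) + 1) by ring.
  by apply: Rmult_le_compat => //; exact: Rabs_pos.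
have -> : L' * (Rabs (g a) + 1) * norm (vsub x y) =
    (Rabs (g a) + 1) * (L' * norm (vsub x y)) by ring.
by apply: Rmult_le_compat => //; exact: Rabs_pos.
Qed.

Lemma loc_lip_rsum m (g : vec n -> 'I_m -> R) a :
  (forall i, loc_lip (fun x => g x i) a) -> loc_lip (fun x => rsum m (g x)) a.
Proof.
move=> h; apply: (loc_lip_eq_near (fun x => lsum (enum 'I_m) (g x)) _ _ 1 Rlt_0_1).
  by move=> x _; rewrite rsumE.
elim: (enum _) => [|i s IH] /=; first exact: loc_lip_const.
exact: loc_lip_add.
Qed.

(* Mean value theorem along segments of a small ball. *)
Lemma C1_loc_lip (U : vec n -> Prop) g (G : vec n -> vec n) a : is_open U -> U a ->
  (forall x, U x -> is_grad g x (G x)) ->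
  (forall j, continuous_on U (fun x => G x j)) -> loc_lip g a.
Proof.
move=> oU Ua hg cG; case: (oU a Ua) => r [r0 hr].
have [d [d0 hd]] : exists d, 0 < d /\ forall j y, U y -> norm (vsub y a) < d ->
    Rabs (G y j - G a j) < 1.
  apply: (uniform_pos _ (fun j d => forall y, U y -> norm (vsub y a) < d ->
    Rabs (G y j - G a j) < 1)).
    by move=> j d d' dd' H y Uy hy; apply: H => //; lra.
  by move=> j; exact: (cG j a Ua 1 Rlt_0_1).
(* A bound for [norm (G z)] on the ball, since each entry of [G] differs there from its value at [a]
   by less than [1]. *)
pose M := norm (G a) + INR n * 1.
have M0 : 0 <= M by rewrite /M; have := norm_ge0 _ (G a); have := pos_INR n; lra.
have rd0 : 0 < Rmin r d by exact: Rmin_glb_lt.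
exists (Rmin r d), M; split=> //; split=> // x y hx hy.
pose seg t : vec n := vadd y (vscal _ t (vsub x y)).
have segB t : 0 <= t <= 1 -> norm (vsub (seg t) a) < Rmin r d.
  move=> t01.
  have -> : vsub (seg t) a = vadd (vscal _ t (vsub x a)) (vscal _ (1 - t) (vsub y a)).
    by apply: functional_extensionality => i; rewrite /seg /vsub /vadd /vscal; ring.
  apply: Rle_lt_trans (norm_triangle _ _ _) _.
  rewrite !norm_vscal !Rabs_pos_eq; try lra.
  case: (Rle_lt_or_eq_dec 0 t (proj1 t01)) => [t0|<-]; last by lra.
  have h1 : t * norm (vsub x a) < t * Rmin r d by apply: Rmult_lt_compat_l.
  have h2 : (1 - t) * norm (vsub y a) <= (1 - t) * Rmin r d by apply: Rmult_le_compat_l; lra.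
  by lra.
have segU t : 0 <= t <= 1 -> U (seg t).
  by move=> /segB h; apply: hr; apply: Rlt_le_trans h (Rmin_l _ _).
have hder t : 0 <= t <= 1 ->
    derivable_pt_lim (fun s => g (seg s)) t (dot (G (seg t)) (vsub x y)).
  move=> t01; apply: is_grad_comp_curve; first exact/hg/segU.
  move=> i; rewrite /seg /vadd /vscal.
  have e : vsub x y i = 0 + (1 * vsub x y i + t * 0) by ring.
  rewrite {2}e.
  apply: (derivable_pt_lim_plus (fct_cte (y i)) (mult_fct id (fct_cte (vsub x y i))) t).
    exact: derivable_pt_lim_const.
  apply: (derivable_pt_lim_mult id); first exact: derivable_pt_lim_id.
  exact: derivable_pt_lim_const.
have [c [e c01]] := MVT_cor2 _ _ 0 1 Rlt_0_1 hder.
have e1 : seg 1 = x by apply: functional_extensionality => i; rewrite /seg /vadd /vscal /vsub; ring.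
have e2 : seg 0 = y by apply: functional_extensionality => i; rewrite /seg /vadd /vscal /vsub; ring.
rewrite -{1}e1 -{1}e2 e Rminus_0_r Rmult_1_r.
apply: Rle_trans (Cauchy_Schwarz _ _ _) _.
apply: Rmult_le_compat_r; first exact: norm_ge0.
have c01' : 0 <= c <= 1 by lra.
rewrite -(vaddK _ (G a) (G (seg c))).
apply: Rle_trans (norm_triangle _ _ _) _; apply: Rplus_le_compat_l.
apply: norm_le_bound => i; apply/Rlt_le/hd; first exact: segU.
exact: Rlt_le_trans (segB c c01') (Rmin_r _ _).
Qed.

Lemma continuous_on_loc_lip (U : vec n -> Prop) g :
  (forall a, U a -> loc_lip g a) -> continuous_on U g.
Proof.
move=> h a Ua eps eps0; case: (loc_lip_cont _ _ (h a Ua) eps eps0) => d [d0 hd].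
by exists d; split=> // y _; exact: hd.
Qed.

End LocallyLipschitz.

Lemma C1_on_loc_lip n m (U : vec n -> Prop) (F : vec n -> vec m) a i :
  is_open U -> C1_on U F -> U a -> loc_lip (fun x => F x i) a.
Proof.
move=> oU [DF [hDF cDF]] Ua; apply: (C1_loc_lip _ U _ (fun x => DF x i)) => //.
by move=> x Ux; exact/is_deriv_coord/hDF.
Qed.

(** * Bolzano-Weierstrass and compactness through cluster points *)

(** An adherent value [l] is approached within [1/(k+1)] at some index beyond [k], chosen as [g k].
    Only [k <= g k] is recorded of the index map, which suffices for composition with it to preserve
    limits. *)
Lemma bounded_real_subseq (v : nat -> R) B : (forall k, Rabs (v k) <= B) ->
  exists g l, (forall k, (k <= g k)%nat) /\ Un_cv (fun k => v (g k)) l.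
Proof.
move=> hB.
have [l hl] : exists l, ValAdh v l.
  apply: (Bolzano_Weierstrass v _ (compact_P3 (- B) B)) => k.
  by have := hB k; split_Rabs; lra.
have ex k : exists p, (k <= p)%coq_nat /\ Rabs (v p - l) < / INR k.+1.
  have k0 : 0 < / INR k.+1 by apply/Rinv_0_lt_compat/lt_0_INR; lia.
  apply: (hl (fun y => Rabs (y - l) < / INR k.+1)).
  by exists (mkposreal _ k0) => y.
pose g k := proj1_sig (constructive_indefinite_description _ (ex k)).
have hg k : (k <= g k)%coq_nat /\ Rabs (v (g k) - l) < / INR k.+1.
  exact: proj2_sig (constructive_indefinite_description _ (ex k)).
exists g, l; split; first by move=> k; have := hg k; lia.
move=> eps eps0; have [K [hK K0]] := archimed_cor1 eps eps0.
exists K => k hk; apply: Rlt_trans (proj2 (hg k)) _; apply: Rle_lt_trans hK.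
by apply: Rinv_le_contravar; [apply: lt_0_INR; lia|apply: le_INR; lia].
Qed.

(** Subsequences are extracted one coordinate after another, each extraction keeping the limits
    already obtained; the l1 distance to the vector of limits then tends to [0]. *)
Lemma bounded_cluster n (u : nat -> vec n) B : (forall k, norm (u k) <= B) ->
  exists a, forall eps, 0 < eps -> forall K, exists k, (K <= k)%nat /\ norm (vsub (u k) a) < eps.
Proof.
move=> hB.
have [g [hg cv]] : exists g, (forall k, (k <= g k)%nat) /\
    forall i, i \in enum 'I_n -> exists l, Un_cv (fun k => u (g k) i) l.
  elim: (enum _) => [|i s [g [hg cv]]]; first by exists (fun k => k); split.
  have [k|h [l [hh hl]]] := bounded_real_subseq (fun k => u (g k) i) B.
    exact: Rle_trans (Rabs_coord_le _ _ i) (hB _).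
  exists (fun k => g (h k)); split=> [k|j]; first exact: leq_trans (hh k) (hg _).
  rewrite inE => /orP[/eqP ->|/cv[l' hl']]; first by exists l.
  exists l' => eps /hl'[K hK]; exists K => k hk; apply: hK.
  by have := hh k; lia.
have ex i : exists l, Un_cv (fun k => u (g k) i) l by apply: cv; rewrite mem_enum.
pose a i := proj1_sig (constructive_indefinite_description _ (ex i)).
have ha i : Un_cv (fun k => u (g k) i) (a i).
  exact: proj2_sig (constructive_indefinite_description _ (ex i)).
have cvs : Un_cv (fun k => lsum (enum 'I_n) (fun i => Rabs (u (g k) i - a i))) 0.
  elim: (enum _) => [|i s IH] /=.
    by move=> eps eps0; exists 0%nat => k _; rewrite /Rdist Rminus_eq_0 Rabs_R0.
  rewrite -(Rplus_0_l 0).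
  apply: (CV_plus (fun k => Rabs (u (g k) i - a i))) => // eps /(ha i)[K hK].
  by exists K => k /hK; rewrite /Rdist Rminus_0_r Rabs_Rabsolu.
exists a => eps /cvs[K0 hK0] K; exists (g (maxn K0 K)); split.
  by have := hg (maxn K0 K); lia.
apply: Rle_lt_trans (norm_le_l1 _ _) _; rewrite rsumE.
have := hK0 (maxn K0 K) ltac:(lia); rewrite /Rdist Rminus_0_r.
exact: Rle_lt_trans (Rle_abs _).
Qed.

(* The form of compactness used by all arguments below: if for arbitrarily small [eta] some
   point of [A] is bad, then bad points accumulate at a point of [A]. *)
Definition cluster_compact {n} (A : vec n -> Prop) : Prop :=
  forall bad : R -> vec n -> Prop,
    (forall eta, 0 < eta -> exists x, A x /\ bad eta x) ->
    exists a, A a /\ forall eps, 0 < eps ->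
      exists eta x, 0 < eta < eps /\ A x /\ norm (vsub x a) < eps /\ bad eta x.

(** A bad point is chosen for each [eta = 1/(k+1)]. Boundedness gives this sequence a cluster point,
    and closedness puts it in [A]. *)
Lemma bounded_closed_cluster_compact n (A : vec n -> Prop) B :
  (forall x, A x -> norm x <= B) ->
  (forall a, (forall eps, 0 < eps -> exists x, A x /\ norm (vsub x a) < eps) -> A a) ->
  cluster_compact A.
Proof.
move=> hB clA bad hbad.
have pos k : 0 < / INR k.+1 by apply/Rinv_0_lt_compat/lt_0_INR; lia.
pose u k := proj1_sig (constructive_indefinite_description _ (hbad _ (pos k))).
have hu k : A (u k) /\ bad (/ INR k.+1) (u k).
  exact: proj2_sig (constructive_indefinite_description _ (hbad _ (pos k))).
have [k|a ha] := bounded_cluster n u B; first exact: hB (proj1 (hu k)).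
have acc eps : 0 < eps ->
    exists eta x, 0 < eta < eps /\ A x /\ norm (vsub x a) < eps /\ bad eta x.
  move=> eps0; have [K [hK K0]] := archimed_cor1 eps eps0.
  have [k [hk hka]] := ha eps eps0 K; have [Ak bk] := hu k.
  exists (/ INR k.+1), (u k); split=> //; split=> //; apply: Rle_lt_trans hK.
  by apply: Rinv_le_contravar; [apply: lt_0_INR; lia|apply: le_INR; lia].
exists a; split=> //; apply: clA => eps /acc[eta [x [_ [Ax [hx _]]]]].
by exists x.
Qed.

(** * Consequences of compactness, and extension of Lipschitz functions *)

Section Compactness.
Variable n : nat.
Implicit Types (A S W : vec n -> Prop) (g : vec n -> R).

Lemma is_open_ball (z : vec n) r : is_open (fun x => norm (vsub x z) < r).
Proof.
move=> x hx; exists (r - norm (vsub x z)); split=> [|y hy]; first by lra.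
by have := norm_vsub_triangle _ y x z; lra.
Qed.

Lemma is_compact_bounded S : is_compact S -> exists B, forall x, S x -> norm x <= B.
Proof.
move=> cS.
have [|x Sx|l hl] := cS nat (fun k x => norm (vsub x (fun _ => 0)) < INR k).
- by move=> k; exact: is_open_ball.
- have [k hk] := INR_unbounded (norm (vsub x (fun=> 0))); by exists k.
have [B hB] : exists B, forall k, List.In k l -> INR k <= B.
  elim: l {hl} => [|k l [B hB]]; first by exists 0.
  exists (Rmax (INR k) B) => j [<-|/hB]; first exact: Rmax_l.
  by have := Rmax_r (INR k) B; lra.
exists B => x /hl[k [/hB hk]].
have -> : vsub x (fun=> 0) = x by apply: functional_extensionality => i; rewrite /vsub; ring.
by lra.
Qed.

(** A Lebesgue number argument: [S] is covered by balls whose doubles lie in [W], and the least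
    radius of a finite subcover works for [d]. *)
Lemma is_compact_thickening S W : is_compact S -> is_open W -> (forall x, S x -> W x) ->
  exists d, 0 < d /\ forall s x, S s -> norm (vsub x s) < d -> W x.
Proof.
move=> cS oW SW.
(* The cover is indexed by pairs of a centre and a radius, with the proof that the doubled ball lies
   in [W]. *)
pose I := {p : vec n * R | 0 < p.2 /\ forall y, norm (vsub y p.1) < 2 * p.2 -> W y}.
have [||l hl] := cS I (fun p x => norm (vsub x (sval p).1) < (sval p).2).
- by move=> p; exact: is_open_ball.
- move=> x Sx; have [e [e0 he]] := oW x (SW x Sx).
  have hp : 0 < (x, e / 2).2 /\ forall y, norm (vsub y (x, e / 2).1) < 2 * (x, e / 2).2 -> W y.
    by split=> /= [|y hy]; [lra|apply: he; lra].
  by exists (exist _ (x, e / 2) hp); rewrite /= norm_vsubxx; lra.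
have [d [d0 hd]] : exists d, 0 < d /\ forall p, List.In p l -> d <= (sval p).2.
  elim: l {hl} => [|p l [d [d0 hd]]]; first by exists 1; split; [lra|].
  have p0 := proj1 (svalP p).
  exists (Rmin (sval p).2 d); split; first exact: Rmin_glb_lt.
  by move=> q [<-|/hd]; [exact: Rmin_l|have := Rmin_r (sval p).2 d; lra].
exists d; split=> // s x Ss hx; have [p [pl hp]] := hl s Ss.
apply: (proj2 (svalP p)).
by have := hd p pl; have := norm_vsub_triangle _ x s (sval p).1; lra.
Qed.

Lemma cluster_compact_bounded A g : cluster_compact A -> (forall a, A a -> cont_at g a) ->
  exists M, 0 <= M /\ forall x, A x -> Rabs (g x) <= M.
Proof.
move=> cA cg; apply: NNPP => no.
have [eta eta0|a [Aa ha]] := cA (fun eta x => / eta < Rabs (g x)).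
  apply: NNPP => no'; apply: no; exists (/ eta); split.
    exact/Rlt_le/Rinv_0_lt_compat.
  by move=> x Ax; apply: Rnot_lt_le => h; apply: no'; exists x.
have [d [d0 hd]] := cg a Aa 1 Rlt_0_1.
have ga := Rabs_pos (g a).
have e0 : 0 < Rmin d (/ (Rabs (g a) + 1)).
  by apply: Rmin_glb_lt => //; apply: Rinv_0_lt_compat; lra.
have [eta [x [[eta0 eta1] [Ax [hx bx]]]]] := ha _ e0.
have h1 := hd x (Rlt_le_trans _ _ _ hx (Rmin_l _ _)).
have h2 := Rlt_le_trans _ _ _ eta1 (Rmin_r _ _).
have h3 : Rabs (g a) + 1 < / eta.
  by rewrite -(Rinv_inv (Rabs (g a) + 1)); apply: Rinv_0_lt_contravar.
by have := Rabs_triang (g x - g a) (g a); rewrite Rplus_comm Rplus_minus; lra.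
Qed.

(** Otherwise there are pairs in [A] with slope above [1 / eta] for every [eta]. Since [g] is
    bounded on [A], the two points of a pair come together as [eta] tends to [0], so near a cluster
    point they enter a ball where the slope is at most [L]. *)
Lemma cluster_compact_lipschitz A g : cluster_compact A -> (forall a, A a -> loc_lip g a) ->
  exists L, 0 <= L /\ forall x y, A x -> A y -> Rabs (g x - g y) <= L * norm (vsub x y).
Proof.
move=> cA lg.
have [a /lg|M [M0 hM]] := cluster_compact_bounded A g cA; first exact: loc_lip_cont.
apply: NNPP => no.
have [eta eta0|a [Aa ha]] :=
    cA (fun eta x => exists y, A y /\ / eta * norm (vsub x y) < Rabs (g x - g y)).
  apply: NNPP => no'; apply: no; exists (/ eta); split.
    exact/Rlt_le/Rinv_0_lt_compat.
  move=> x y Ax Ay; apply: Rnot_lt_le => h; apply: no'.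
  by exists x; split=> //; exists y.
have [rho [L [rho0 [L0 hL]]]] := lg a Aa.
(* The three bounds place [x] within [rho / 2] of [a], make [1 / eta] exceed [L + 1], and force [x]
   and [y] within [rho / 2] of each other. *)
have e0 : 0 < Rmin (rho / 2) (Rmin (/ (L + 1)) (rho / 2 / (2 * M + 1))).
  apply: Rmin_glb_lt; first by lra.
  by apply: Rmin_glb_lt; [apply: Rinv_0_lt_compat; lra|apply: Rdiv_lt_0_compat; lra].
have [eta [x [[eta0 eta1] [Ax [hx [y [Ay hy]]]]]]] := ha _ e0.
have r1 := Rmin_l (rho / 2) (Rmin (/ (L + 1)) (rho / 2 / (2 * M + 1))).
have r2 := Rmin_r (rho / 2) (Rmin (/ (L + 1)) (rho / 2 / (2 * M + 1))).
have r3 := Rmin_l (/ (L + 1)) (rho / 2 / (2 * M + 1)).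
have r4 := Rmin_r (/ (L + 1)) (rho / 2 / (2 * M + 1)).
have ie : L + 1 < / eta.
  by rewrite -(Rinv_inv (L + 1)); apply: Rinv_0_lt_contravar; lra.
have nxy := norm_ge0 _ (vsub x y).
have xy : norm (vsub x y) < rho / 2.
  have gM : Rabs (g x - g y) <= 2 * M.
    have := Rabs_triang (g x) (- g y); rewrite Rabs_Ropp -/(Rminus _ _).
    by have := hM x Ax; have := hM y Ay; lra.
  have h1 : norm (vsub x y) < eta * (2 * M + 1).
    have -> : norm (vsub x y) = eta * (/ eta * norm (vsub x y)) by field; lra.
    by apply: Rmult_lt_compat_l; lra.
  have h2 : eta * (2 * M + 1) < rho / 2 by apply/Rlt_div_r; lra.
  by lra.
have hy' : norm (vsub y a) < rho.
  by have := norm_vsub_triangle _ y x a; rewrite (norm_vsubC _ y x); lra.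
have := hL x y ltac:(lra) hy'.
by have := Rmult_le_compat_r _ _ _ nxy (Rlt_le _ _ ie); lra.
Qed.

(* McShane's formula: the extension is the infimum over [z] in [A] of [g z + L |x - z|]. *)
Lemma lipschitz_extension A g L : (exists z, A z) -> 0 <= L ->
  (forall x y, A x -> A y -> Rabs (g x - g y) <= L * norm (vsub x y)) ->
  exists g' : vec n -> R, (forall x, A x -> g' x = g x) /\
    forall x y, Rabs (g' x - g' y) <= L * norm (vsub x y).
Proof.
move=> [z0 Az0] L0 hL.
(* Values are negated so that the infimum becomes a least upper bound; the extension is [- m x]. *)
pose E x (r : R) := exists z, A z /\ r = - (g z + L * norm (vsub x z)).
have ex x : exists m, is_lub (E x) m.
  suff [m hm] : {m | is_lub (E x) m} by exists m.
  apply: completeness; last by exists (- (g z0 + L * norm (vsub x z0))), z0.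
  exists (L * norm (vsub z0 x) - g z0) => r [z [Az ->]].
  have := hL z0 z Az0 Az; have := Rle_abs (g z0 - g z).
  by have := Rmult_le_compat_l L _ _ L0 (norm_vsub_triangle _ z0 x z); lra.
pose m x := proj1_sig (constructive_indefinite_description _ (ex x)).
have hm x : is_lub (E x) (m x).
  exact: proj2_sig (constructive_indefinite_description _ (ex x)).
have half x y : m x - m y <= L * norm (vsub x y).
  suff: m x <= m y + L * norm (vsub x y) by lra.
  apply: (proj2 (hm x)) => r [z [Az ->]].
  have : - (g z + L * norm (vsub y z)) <= m y by apply: (proj1 (hm y)); exists z.
  have := Rmult_le_compat_l L _ _ L0 (norm_vsub_triangle _ y x z).
  by rewrite (norm_vsubC _ y x); lra.
exists (fun x => - m x); split=> [x Ax|x y].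
  have h1 : - (g x + L * norm (vsub x x)) <= m x by apply: (proj1 (hm x)); exists x.
  have h2 : m x <= - g x.
    apply: (proj2 (hm x)) => r [z [Az ->]].
    by have := hL x z Ax Az; have := Rle_abs (g x - g z); lra.
  by rewrite norm_vsubxx in h1; lra.
have := half x y; have := half y x; rewrite (norm_vsubC _ y x).
by split_Rabs; lra.
Qed.

End Compactness.

(** * Geometric convergence and exponential bounds on integrals *)

Lemma geometric_limit (a : nat -> R) C :
  (forall k, Rabs (a k.+1 - a k) <= C * (/ 2) ^ k) ->
  exists l, forall k, Rabs (a k - l) <= 2 * C * (/ 2) ^ k.
Proof.
move=> ha.
have C0 : 0 <= C by have := ha 0%nat; have := Rabs_pos (a 1%nat - a 0%nat); rewrite /=; lra.
(* The factor [1 - (/ 2) ^ m] is the partial geometric sum, kept exact so that the induction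
   closes. *)
have gap k m : Rabs (a (k + m)%nat - a k) <= 2 * C * (/ 2) ^ k * (1 - (/ 2) ^ m).
  elim: m => [|m IH]; first by rewrite addn0 Rminus_eq_0 Rabs_R0 /=; lra.
  rewrite addnS; have := ha (k + m)%nat; rewrite pow_add /= => h.
  have := Rabs_triang (a (k + m).+1 - a (k + m)%nat) (a (k + m)%nat - a k).
  have -> : a (k + m).+1 - a (k + m)%nat + (a (k + m)%nat - a k) = a (k + m).+1 - a k by ring.
  by lra.
have gap' k m : Rabs (a (k + m)%nat - a k) <= 2 * C * (/ 2) ^ k.
  apply: Rle_trans (gap k m) _; rewrite -{2}(Rmult_1_r (2 * C * (/ 2) ^ k)).
  have := pow_le (/ 2) m ltac:(lra); have := pow_le (/ 2) k ltac:(lra) => p1 p2.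
  by apply: Rmult_le_compat_l; [nra|lra].
have small eps : 0 < eps -> exists K, 2 * C * (/ 2) ^ K < eps.
  move=> eps0; have e0 : 0 < eps / (2 * C + 1) by apply: Rdiv_lt_0_compat; lra.
  have [K hK] := pow_lt_1_zero (/ 2) ltac:(rewrite Rabs_pos_eq; lra) _ e0.
  exists K; have := hK K (le_n K); have pK := pow_le (/ 2) K ltac:(lra).
  by rewrite Rabs_pos_eq // => /Rlt_div_r; lra.
have cauchy : Cauchy_crit a.
  move=> eps eps0; have [K hK] := small (eps / 2) ltac:(lra).
  exists K => i j hi hj; rewrite /Rdist.
  have := gap' K (i - K)%nat; have := gap' K (j - K)%nat.
  have -> : (K + (i - K))%nat = i by lia.
  have -> : (K + (j - K))%nat = j by lia.
  move=> h1 h2; have -> : a i - a j = (a i - a K) + - (a j - a K) by ring.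
  by have := Rabs_triang (a i - a K) (- (a j - a K)); rewrite Rabs_Ropp; lra.
have [l hl] := Stdlib.Reals.Rcomplete.R_complete a cauchy.
exists l => k; apply: Rnot_lt_le => h.
have [K hK] := hl (Rabs (a k - l) - 2 * C * (/ 2) ^ k) ltac:(lra).
have := hK (k + K)%nat ltac:(lia); have := gap' k K; rewrite /Rdist.
have := Rabs_triang (a (k + K)%nat - l) (- (a (k + K)%nat - a k)); rewrite Rabs_Ropp.
have -> : a (k + K)%nat - l + - (a (k + K)%nat - a k) = a k - l by ring.
by lra.
Qed.

Lemma eq_of_geometric_bound x y C : (forall k, Rabs (x - y) <= C * (/ 2) ^ k) -> x = y.
Proof.
move=> h; apply: NNPP => ne.
have d0 : 0 < Rabs (x - y) by apply: Rabs_pos_lt; lra.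
have C0 : 0 < C by have := h 0%nat; rewrite /=; lra.
have e0 : 0 < Rabs (x - y) / C by exact: Rdiv_lt_0_compat.
have [K hK] := pow_lt_1_zero (/ 2) ltac:(rewrite Rabs_pos_eq; lra) _ e0.
have := hK K (le_n K); have pK := pow_le (/ 2) K ltac:(lra).
by rewrite Rabs_pos_eq // => /Rlt_div_r; have := h K; lra.
Qed.

Lemma exp_monotone x y : x <= y -> exp x <= exp y.
Proof. by case=> [/exp_increasing/Rlt_le|->]; [|exact: Rle_refl]. Qed.

Lemma ex_RInt_continuity (g : R -> R) a b : continuity g -> ex_RInt g a b.
Proof. by move=> cg; apply: ex_RInt_continuous => z _; exact/continuity_pt_filterlim/cg. Qed.

Lemma derivable_pt_lim_RInt (g : R -> R) c t : continuity g ->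
  derivable_pt_lim (fun s => c + RInt g 0 s) t (g t).
Proof.
move=> cg; rewrite -(Rplus_0_l (g t)).
apply: (derivable_pt_lim_plus (fct_cte c)); first exact: derivable_pt_lim_const.
apply/is_derive_Reals; apply: (is_derive_RInt g _ 0 t); last exact/continuity_pt_filterlim/cg.
by apply: filter_forall => s; exact/RInt_correct/ex_RInt_continuity.
Qed.

Lemma continuity_RInt (g : R -> R) c : continuity g -> continuity (fun s => c + RInt g 0 s).
Proof.
move=> cg t; apply: derivable_continuous_pt; exists (g t).
exact: derivable_pt_lim_RInt.
Qed.

(** The bound on the integrands is the derivative of [A * exp (b * s)]. Integration thus divides by
    [b], the gain that makes the Picard map contract in an exponentially weighted norm. *)
Lemma RInt_exp_bound (g h : R -> R) A b t : continuity g -> continuity h -> 0 <= A -> 0 <= t ->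
  (forall s, 0 <= s -> Rabs (g s - h s) <= A * (b * exp (b * s))) ->
  Rabs (RInt g 0 t - RInt h 0 t) <= A * exp (b * t).
Proof.
move=> cg ch A0 t0 hgh.
have ig := ex_RInt_continuity g 0 t cg; have ih := ex_RInt_continuity h 0 t ch.
have cgh : continuity (fun s => g s - h s) by exact: continuity_minus.
have igh := ex_RInt_continuity _ 0 t cgh.
have -> : RInt g 0 t - RInt h 0 t = RInt (fun s => g s - h s) 0 t.
  by rewrite (RInt_minus g h 0 t ig ih).
have iexp : is_RInt (fun s => A * (b * exp (b * s))) 0 t (A * exp (b * t) - A * exp (b * 0)).
  apply: (is_RInt_derive (fun s => A * exp (b * s))).
    by move=> s _; auto_derive => //; ring.
  by move=> s _; apply: ex_derive_continuous; auto_derive.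
apply: Rle_trans (abs_RInt_le _ _ _ t0 igh) _.
apply: (Rle_trans _ (RInt (fun s => A * (b * exp (b * s))) 0 t)).
  apply: RInt_le => //.
  - apply: ex_RInt_continuity => s.
    by apply: (continuity_pt_comp (fun s => g s - h s)); [exact: cgh|exact: Rcontinuity_abs].
  - by exists (A * exp (b * t) - A * exp (b * 0)).
  by move=> s hs; apply: hgh; lra.
rewrite (is_RInt_unique _ _ _ _ iexp).
by have := exp_pos (b * 0); nra.
Qed.

(** * Picard iteration for a globally Lipschitz field *)

Section Picard.
Variables (n : nat) (F : vec n -> vec n) (L : R) (p : vec n).
Hypothesis L0 : 0 <= L.
Hypothesis lipF : forall x y i, Rabs (F x i - F y i) <= L * norm (vsub x y).

Lemma continuity_lipschitz_comp (w : R -> vec n) i :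
  (forall j, continuity (fun s => w s j)) -> continuity (fun s => F (w s) i).
Proof.
move=> cw t eps eps0.
have e0 : 0 < eps / (L + 1) by apply: Rdiv_lt_0_compat; lra.
have [d [d0 hd]] := curve_continuous _ w t (fun j => cw j t) _ e0.
exists d; split=> // s [_ /hd h3].
apply: Rle_lt_trans (lipF _ _ _) _.
have := Rmult_lt_compat_r (L + 1) _ _ ltac:(lra) h3.
have -> : eps / (L + 1) * (L + 1) = eps by field; lra.
by have := norm_ge0 _ (vsub (w s) (w t)); lra.
Qed.

Lemma lipschitz_coord_bound x y i c : (forall j, Rabs (x j - y j) <= c) ->
  Rabs (F x i - F y i) <= L * (INR n * c).
Proof.
move=> h; apply: Rle_trans (lipF _ _ _) _; apply: Rmult_le_compat_l => //.
exact: norm_le_bound.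
Qed.

(** The clamp [Rmax 0] freezes the integrand at time [0] for negative times: estimates concern
    [t >= 0] only, while integrands stay continuous on the whole line. *)
Fixpoint picard (k : nat) : R -> vec n :=
  if k is k'.+1 then fun t i => p i + RInt (fun s => F (picard k' (Rmax 0 s)) i) 0 t
  else fun _ => p.

Lemma continuity_comp_Rmax0 (g : R -> R) : continuity g -> continuity (fun s => g (Rmax 0 s)).
Proof.
move=> cg t; apply: (continuity_pt_comp (Rmax 0)); last exact: cg.
move=> eps eps0; exists eps; split=> // s [_]; rewrite /= /Rdist.
apply: Rle_lt_trans; rewrite /Rmax; do 2! case: Rle_dec => ? /=; split_Rabs; lra.
Qed.

Lemma continuity_picard k i : continuity (fun t => picard k t i).
Proof.
elim: k i => [|k IH] i /=; first by apply: continuity_const.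
apply: continuity_RInt; apply: continuity_lipschitz_comp => j.
exact: (continuity_comp_Rmax0 (fun s => picard k s j)).
Qed.

(* Large enough that the Picard map halves distances weighted by [exp (- rate * t)]. *)
Let rate := 2 * (INR n * L) + 1.
Let M := norm (F p).

Lemma rate_ge1 : 1 <= rate.
Proof. by rewrite /rate; have := Rmult_le_pos _ _ (pos_INR n) L0; lra. Qed.

Lemma picard_step k t i : 0 <= t ->
  Rabs (picard k.+1 t i - picard k t i) <= M * exp (rate * t) * (/ 2) ^ k.
Proof.
have M0 : 0 <= M by exact: norm_ge0.
have r1 := rate_ge1.
elim: k t i => [|k IH] t i t0.
  rewrite /= RInt_const /scal /= /mult /=.
  have -> : p i + (t - 0) * F p i - p i = F p i * t by ring.
  rewrite Rabs_mult (Rabs_pos_eq t) // Rmult_1_r.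
  apply: Rmult_le_compat => //; [exact: Rabs_pos|exact: Rabs_coord_le|].
  (* Here [t <= 1 + rate * t <= exp (rate * t)], as [rate >= 1]. *)
  by have := exp_ineq1_le (rate * t); nra.
have -> : picard k.+2 t i - picard k.+1 t i =
    RInt (fun s => F (picard k.+1 (Rmax 0 s)) i) 0 t -
    RInt (fun s => F (picard k (Rmax 0 s)) i) 0 t.
  by rewrite /=; ring.
have -> : M * exp (rate * t) * (/ 2) ^ k.+1 = (M * (/ 2) ^ k.+1) * exp (rate * t) by ring.
have pk := pow_lt (/ 2) k ltac:(lra).
have Mk : 0 <= M * (/ 2) ^ k by nra.
apply: RInt_exp_bound => //.
- apply: continuity_lipschitz_comp => j.
  exact: (continuity_comp_Rmax0 (fun s => picard k.+1 s j) (continuity_picard k.+1 j)).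
- apply: continuity_lipschitz_comp => j.
  exact: (continuity_comp_Rmax0 (fun s => picard k s j) (continuity_picard k j)).
- by rewrite /=; lra.
move=> s s0; rewrite Rmax_right //.
apply: Rle_trans (lipschitz_coord_bound _ _ _ _ (fun j => IH s j s0)) _.
have ep := exp_pos (rate * s).
have := Rmult_le_pos _ _ Mk (Rlt_le _ _ ep).
set e := M * (/ 2) ^ k * exp (rate * s) => e0.
have -> : L * (INR n * (M * exp (rate * s) * (/ 2) ^ k)) = INR n * L * e by rewrite /e; ring.
have -> : M * (/ 2) ^ k.+1 * (rate * exp (rate * s)) = rate * / 2 * e by rewrite /e /=; ring.
by apply: Rmult_le_compat_r => //; rewrite /rate; lra.
Qed.

(** The iterates converge uniformly on bounded intervals of nonnegative times, so their limit is
    continuous and satisfies the integral equation. *)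
Lemma lipschitz_global_flow : exists phi : R -> vec n, phi 0 = p /\
  forall t, 0 <= t -> forall i, derivable_pt_lim (fun s => phi s i) t (F (phi t) i).
Proof.
have M0 : 0 <= M by exact: norm_ge0.
have r1 := rate_ge1.
have ex t i : exists l, forall k,
    Rabs (picard k (Rmax 0 t) i - l) <= 2 * (M * exp (rate * Rmax 0 t)) * (/ 2) ^ k.
  by apply: geometric_limit => k; apply: picard_step; exact: Rmax_l.
pose w t i := proj1_sig (constructive_indefinite_description _ (ex t i)).
have hw t i k : Rabs (picard k (Rmax 0 t) i - w t i) <= 2 * (M * exp (rate * Rmax 0 t)) * (/ 2) ^ k.
  exact: (proj2_sig (constructive_indefinite_description _ (ex t i)) k).
have cw i : continuity (fun t => w t i).
  move=> t eps eps0.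
  (* For [s] within [1] of [t] the clamped time is at most [Rabs t + 1], so [C] gives a uniform rate
     there and a three-epsilon argument applies. *)
  pose C := 2 * (M * exp (rate * (Rabs t + 1))).
  have C0 : 0 <= C by rewrite /C; have := exp_pos (rate * (Rabs t + 1)); nra.
  have unif s k : Rabs (s - t) < 1 -> Rabs (picard k (Rmax 0 s) i - w s i) <= C * (/ 2) ^ k.
    move=> hs; apply: Rle_trans (hw s i k) _.
    apply: Rmult_le_compat_r; first by apply: pow_le; lra.
    apply: Rmult_le_compat_l; first by lra.
    apply: Rmult_le_compat_l => //; apply: exp_monotone; apply: Rmult_le_compat_l; first by lra.
    apply: Rmax_lub; first by have := Rabs_pos t; lra.
    by move: hs; split_Rabs; lra.
  have e0 : 0 < eps / 3 / (C + 1) by apply: Rdiv_lt_0_compat; lra.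
  have [k hk] := pow_lt_1_zero (/ 2) ltac:(rewrite Rabs_pos_eq; lra) _ e0.
  have := hk k (le_n k); have pk := pow_le (/ 2) k ltac:(lra).
  rewrite Rabs_pos_eq // => /Rlt_div_r => h1; have {}h1 := h1 ltac:(lra).
  have [d [d0 hd]] := continuity_comp_Rmax0 _ (continuity_picard k i) t (eps / 3) ltac:(lra).
  exists (Rmin d 1); split; first by apply: Rmin_glb_lt; lra.
  move=> s [sD hs].
  have hs1 : Rabs (s - t) < 1 by apply: Rlt_le_trans hs (Rmin_r _ _).
  have h2 := hd s (conj sD (Rlt_le_trans _ _ _ hs (Rmin_l _ _))).
  have h3 := unif s k hs1.
  have := unif t k; rewrite Rminus_eq_0 Rabs_R0 => /(_ Rlt_0_1) h4.
  move: h2 h3 h4; rewrite /= /Rdist; split_Rabs; lra.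
have cFw i : continuity (fun s => F (w s) i) by exact: continuity_lipschitz_comp.
(* The solution is taken as the integral, which has a two-sided derivative even at [0]; it agrees
   with the limit [w] for [t >= 0]. *)
pose phi t i := p i + RInt (fun s => F (w s) i) 0 t.
have phiw t : 0 <= t -> phi t = w t.
  move=> t0; apply: functional_extensionality => i.
  have b1 k : Rabs (picard k.+1 t i - phi t i) <= 2 * M * (/ 2) ^ k * exp (rate * t).
    have -> : picard k.+1 t i - phi t i =
        RInt (fun s => F (picard k (Rmax 0 s)) i) 0 t - RInt (fun s => F (w s) i) 0 t.
      by rewrite /phi /=; ring.
    have pk := pow_lt (/ 2) k ltac:(lra).
    have Mk : 0 <= M * (/ 2) ^ k by nra.
    apply: RInt_exp_bound => //; [|nra|].
      apply: continuity_lipschitz_comp => j.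
      exact: (continuity_comp_Rmax0 (fun s => picard k s j) (continuity_picard k j)).
    move=> s s0.
    apply: Rle_trans (lipschitz_coord_bound _ _ _ _ (fun j => hw s j k)) _.
    rewrite Rmax_right //.
    have := Rmult_le_pos _ _ Mk (Rlt_le _ _ (exp_pos (rate * s))).
    set e := M * (/ 2) ^ k * exp (rate * s) => e0.
    have -> : L * (INR n * (2 * (M * exp (rate * s)) * (/ 2) ^ k)) = 2 * (INR n * L) * e.
      by rewrite /e; ring.
    have -> : 2 * M * (/ 2) ^ k * (rate * exp (rate * s)) = 2 * rate * e by rewrite /e /=; ring.
    apply: Rmult_le_compat_r => //; rewrite /rate.
    by have := Rmult_le_pos _ _ (pos_INR n) L0; lra.
  (* The integral estimate contributes [2 * M], and the distance from iterate [k.+1] to [w]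
     contributes [2 * M / 2]. *)
  apply: (eq_of_geometric_bound _ _ (3 * M * exp (rate * t))) => k.
  have := b1 k; have := hw t i k.+1; rewrite Rmax_right // => h1 h2.
  have := Rabs_triang (- (picard k.+1 t i - phi t i)) (picard k.+1 t i - w t i).
  have -> : - (picard k.+1 t i - phi t i) + (picard k.+1 t i - w t i) = phi t i - w t i by ring.
  rewrite Rabs_Ropp => h3; apply: Rle_trans h3 _.
  by move: h1 h2; rewrite -[(/ 2) ^ k.+1]/(/ 2 * (/ 2) ^ k); lra.
exists phi; split.
  apply: functional_extensionality => i; rewrite /phi RInt_point /zero /=; ring.
by move=> t t0 i; rewrite phiw //; exact: derivable_pt_lim_RInt.
Qed.

End Picard.

(** * The quadratic form and the gradient of [V] *)

Section QuadraticForm.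
Variables (m : nat) (K : mat m m).

Lemma sym_mat_dot v w : sym_mat K -> dot v (mulmv K w) = dot (mulmv K v) w.
Proof.
move=> sK; rewrite /dot /mulmv.
have -> : rsum m (fun i => v i * rsum m (fun j => K i j * w j)) =
          rsum m (fun i => rsum m (fun j => v i * (K i j * w j))).
  by apply: rsum_ext => i; rewrite rsum_scal.
rewrite rsum_exchange; apply: rsum_ext => j.
rewrite Rmult_comm -rsum_scal; apply: rsum_ext => i.
by rewrite (sK i j); ring.
Qed.

Lemma qform_eq0 v : (forall i, v i = 0) -> qform K v = 0.
Proof.
move=> v0; rewrite /qform /dot -(rsum_zero m).
by apply: rsum_ext => i; rewrite v0; ring.
Qed.

Lemma qform_ge0 v : pos_def K -> 0 <= qform K v.
Proof.
move=> pK; case: (classic (exists i, v i <> 0)) => [/pK|h]; first by lra.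
rewrite qform_eq0; first by lra.
by move=> i; apply: NNPP => vi; apply: h; exists i.
Qed.

End QuadraticForm.

Lemma Vfun_ge0 n m (K : mat m m) (f : vec n -> vec m) x0 x : pos_def K -> 0 <= Vfun K f x0 x.
Proof. by move=> pK; rewrite /Vfun; have := qform_ge0 _ _ (vsub (f x) (f x0)) pK; lra. Qed.

(** Both sides are the derivative at [0] of [t -> V (x + t h)], computed through the gradient and
    through the quadratic form, whose two terms agree by symmetry of [K]. This is the formula
    [grad V = Df^T K (f - f x0)] tested on [h]. *)
Lemma Vfun_grad n m (K : mat m m) (f : vec n -> vec m) x0 x D G h :
  sym_mat K -> is_deriv f x D -> is_grad (Vfun K f x0) x G ->
  dot G h = dot (mulmv K (vsub (f x) (f x0))) (mulmv D h).
Proof.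
move=> sK hf hV.
pose seg t : vec n := vadd x (vscal _ t h).
have seg0 : seg 0 = x by apply: functional_extensionality => i; rewrite /seg /vadd /vscal; ring.
have dseg i : derivable_pt_lim (fun t => seg t i) 0 (h i).
  have e : h i = 0 + (1 * h i + 0 * 0) by ring.
  rewrite {1}e; apply: (derivable_pt_lim_plus (fct_cte (x i)) (mult_fct id (fct_cte (h i)))).
    exact: derivable_pt_lim_const.
  by apply: (derivable_pt_lim_mult id); [exact: derivable_pt_lim_id|exact: derivable_pt_lim_const].
pose v t : vec m := vsub (f (seg t)) (f x0).
have dv i : derivable_pt_lim (fun t => v t i) 0 (mulmv D h i).
  rewrite -(Rminus_0_r (mulmv D h i)).
  apply: (derivable_pt_lim_minus (fun t => f (seg t) i) (fct_cte (f x0 i))).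
    apply: (is_grad_comp_curve _ (fun y => f y i) (D i) seg h) => //.
    by rewrite seg0; exact: is_deriv_coord.
  exact: derivable_pt_lim_const.
have d1 : derivable_pt_lim (fun t => Vfun K f x0 (seg t)) 0 (dot G h).
  by apply: is_grad_comp_curve => //; rewrite seg0.
have d2 : derivable_pt_lim (fun t => Vfun K f x0 (seg t)) 0
    (/ 2 * rsum m (fun i => mulmv D h i * mulmv K (v 0) i + v 0 i * mulmv K (mulmv D h) i)).
  apply: (derivable_pt_lim_scal (fun t => qform K (v t))).
  apply: derivable_pt_lim_rsum => i.
  apply: (derivable_pt_lim_mult (fun t => v t i) (fun t => mulmv K (v t) i)) => //.
  by apply: derivable_pt_lim_rsum => j; exact: (derivable_pt_lim_scal (fun t => v t j)).
rewrite (uniqueness_limite _ _ _ _ d1 d2) rsum_add.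
rewrite -/(dot (mulmv D h) (mulmv K (v 0))) -/(dot (v 0) (mulmv K (mulmv D h))).
rewrite (sym_mat_dot _ _ (v 0)) // (dotC _ (mulmv D h)).
by rewrite /v seg0; lra.
Qed.

(** * Decay of a function along trajectories *)

Section Lyapunov.
Variables (n : nat) (D : vec n -> Prop) (Y G : vec n -> vec n) (V : vec n -> R).
Variables (phi : R -> vec n) (T : R).
Hypothesis sol : solution_on D Y phi T.
Hypothesis gradV : forall x, D x -> is_grad V x (G x).
Hypothesis contV : forall x, D x -> cont_at V x.

(** The mean value theorem for [V] along [phi]; [s] is positive because a solution is differentiable
    at interior times only. *)
Lemma solution_decay_rate s t m : 0 < s <= t -> t < T ->
  (forall u, s <= u <= t -> dot (G (phi u)) (Y (phi u)) <= - m) ->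
  V (phi t) <= V (phi s) - m * (t - s).
Proof.
move=> [s0 [st|<-]] tT hm; last by lra.
case: sol => hD [hder _].
have [u hu|u [e hu]] := MVT_cor2 (fun u => V (phi u)) (fun u => dot (G (phi u)) (Y (phi u))) s t st.
  by apply: is_grad_comp_curve; [apply: gradV; apply: hD; lra|move=> i; apply: hder; lra].
by have := hm u ltac:(lra); nra.
Qed.

(** For [s > 0] this is the decay estimate with rate [0]. The case [s = 0] follows by letting
    positive times tend to [0], using right continuity of [phi] and continuity of [V]. *)
Lemma solution_nonincreasing s t : (forall x, D x -> dot (G x) (Y x) <= 0) ->
  0 <= s <= t -> t < T -> V (phi t) <= V (phi s).
Proof.
move=> neg [s0 st] tT; case: sol => hD [_ rc].
have pos u : 0 < u <= t -> V (phi t) <= V (phi u).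
  move=> ut; have := solution_decay_rate u t 0 ut tT.
  rewrite Ropp_0 Rmult_0_l Rminus_0_r; apply => z hz.
  by apply/neg/hD; lra.
case: s0 => [s0|s0]; first exact: pos.
subst s; case: st => [t0|<-]; last by lra.
apply: Rnot_lt_le => lt0.
have [d [d0 hd]] := contV (phi 0) (hD 0 ltac:(lra)) (V (phi t) - V (phi 0)) ltac:(lra).
have [d' [d'0 hd']] := rc d d0.
have u0 : 0 < Rmin (d' / 2) t by apply: Rmin_glb_lt; lra.
have h1 := Rmin_l (d' / 2) t; have h2 := Rmin_r (d' / 2) t.
have := hd _ (hd' (Rmin (d' / 2) t) ltac:(lra)).
have := pos (Rmin (d' / 2) t) ltac:(lra).
by have := Rle_abs (V (phi (Rmin (d' / 2) t)) - V (phi 0)); lra.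
Qed.

End Lyapunov.

(** * Invariance of the sublevel set and convergence to the zero set *)

Theorem theorem4 (n r l : nat) (U : vec n -> Prop) (X : vec n -> vec n)
  (f : vec n -> vec (r + l)) (x0 : vec n) (K : mat (r + l) (r + l))
  (gradV : vec n -> vec n) (W : vec n -> Prop) :
  is_open U ->
  C1_on U X ->
  C2_on U f ->
  U x0 ->
  sym_mat K -> pos_def K ->
  (* gradV is the gradient of V on U *)
  (forall x, U x -> is_grad (Vfun K f x0) x (gradV x)) ->
  (* grad V . X = 0 on U *)
  (forall x, U x -> dot (gradV x) (X x) = 0) ->
  (* V^{-1}(0) is compact *)
  is_compact (fun x => U x /\ Vfun K f x0 x = 0) ->
  is_open W -> (forall x, W x -> U x) ->
  (forall x, U x -> Vfun K f x0 x = 0 -> W x) ->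
  (forall x, W x -> Vfun K f x0 x <> 0 ->
     forall D, is_deriv f x D -> onto D) ->
  exists c, 0 < c /\
  exists U' : vec n -> Prop,
    is_open U' /\ (forall x, U' x -> W x) /\
    (forall x, U x -> Vfun K f x0 x = 0 -> U' x) /\
    let Y := fun x => vsub (X x) (gradV x) in
    let Sc := fun x => U' x /\ 0 <= Vfun K f x0 x <= c in
    (* trajectories starting in V^{-1}([0,c]) exist for all t >= 0 *)
    (forall p, Sc p -> exists phi, phi 0 = p /\
        forall T, 0 < T -> solution_on U' Y phi T) /\
    (* they remain in V^{-1}([0,c]) *)
    (forall phi T, 0 < T -> solution_on U' Y phi T -> Sc (phi 0) ->
        forall t, 0 <= t < T -> Sc (phi t)) /\
    (* and converge to V^{-1}(0) *)
    (forall phi, (forall T, 0 < T -> solution_on U' Y phi T) -> Sc (phi 0) ->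
        converges_to_set phi (fun x => U x /\ Vfun K f x0 x = 0)).
Proof.
move=> oU C1X [Df [hDf C1Df]] Ux0 sK pK hgrad orthX cS oW WU SW ontoW.
set V := Vfun K f x0 in hgrad cS SW ontoW *.
set S := (fun x => U x /\ V x = 0) in cS *.
have V0 x : 0 <= V x by exact: Vfun_ge0.
have Df_lip a i j : U a -> loc_lip (fun x => Df x i j) a.
  by move=> Ua; exact: (C1_on_loc_lip _ _ U (fun x => Df x i) _ j).
have f_lip a i : U a -> loc_lip (fun x => f x i - f x0 i) a.
  move=> Ua; apply: loc_lip_add (loc_lip_const _ _ _).
  apply: (C1_loc_lip _ U _ (fun x => Df x i)) => // [x Ux|j].
    exact/is_deriv_coord/hDf.
  by apply: continuous_on_loc_lip => b; exact: Df_lip.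
have Kf_lip a i : U a -> loc_lip (fun x => mulmv K (vsub (f x) (f x0)) i) a.
  move=> Ua; apply: loc_lip_rsum => j.
  by apply: loc_lip_mult; [exact: loc_lip_const|exact: f_lip].
have V_cont a : U a -> cont_at V a.
  move=> Ua; apply: loc_lip_cont; apply: loc_lip_mult; first exact: loc_lip_const.
  by apply: loc_lip_rsum => i; apply: loc_lip_mult; [exact: f_lip|exact: Kf_lip].
have grad_lip a j : U a -> loc_lip (fun x => gradV x j) a.
  move=> Ua; have [rho [rho0 hrho]] := oU a Ua.
  (* Testing the gradient formula on a basis vector writes each coordinate of [gradV] as a sum of
     products of locally Lipschitz functions. *)
  pose e : vec n := fun k => if k == j then 1 else 0.
  apply: (loc_lip_eq_near _ (fun x => dot (mulmv K (vsub (f x) (f x0))) (fun i => Df x i j))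
            _ _ rho rho0).
    move=> x /hrho Ux; rewrite -(rsum_delta _ (gradV x) j) -/(dot (gradV x) e).
    rewrite (Vfun_grad _ _ _ _ _ _ _ _ e sK (hDf x Ux) (hgrad x Ux)).
    by apply: rsum_ext => i; rewrite /mulmv (rsum_delta _ (Df x i) j).
  by apply: loc_lip_rsum => i; apply: loc_lip_mult; [exact: Kf_lip|exact: Df_lip].
have grad2_cont a : U a -> cont_at (fun x => dot (gradV x) (gradV x)) a.
  move=> Ua; apply/loc_lip_cont/loc_lip_rsum => j.
  by apply: loc_lip_mult; exact: grad_lip.
pose Y x := vsub (X x) (gradV x).
have Y_lip a j : U a -> loc_lip (fun x => Y x j) a.
  move=> Ua; apply: (loc_lip_eq_near _ (fun x => X x j + -1 * gradV x j) _ _ 1 Rlt_0_1).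
    by move=> x _; rewrite /Y /vsub; ring.
  apply: loc_lip_add; first exact: C1_on_loc_lip C1X Ua.
  by apply: loc_lip_mult; [exact: loc_lip_const|exact: grad_lip].
have dotY x : U x -> dot (gradV x) (Y x) = - dot (gradV x) (gradV x).
  by move=> Ux; rewrite /Y dotC dot_subl dotC orthX //; ring.
have SW' x : S x -> W x by move=> [Ux Vx]; exact: SW.
have [d [d0 hd]] := is_compact_thickening _ S W cS oW SW'.
have [B hB] := is_compact_bounded _ S cS.
have cptS : cluster_compact S.
  (* A limit point of [S] is within [d] of [S], hence in [U], where continuity of [V] forces
     [V a = 0]. *)
  apply: (bounded_closed_cluster_compact _ _ B hB) => a ha.
  have Ua : U a.
    have [s [Ss hs]] := ha d d0; apply/WU/(hd s) => //.
    by rewrite norm_vsubC.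
  split=> //; apply: NNPP => Va.
  have [d' [d'0 hd']] := V_cont a Ua (Rabs (V a)) (Rabs_pos_lt _ Va).
  have [s [[_ Vs] hs]] := ha d' d'0; have := hd' s hs.
  by rewrite Vs Rminus_0_l Rabs_Ropp; lra.
(* Radius [d / 2] keeps even the closed tube [N] inside [W]. *)
pose N x := exists s, S s /\ norm (vsub x s) <= d / 2.
pose U' x := exists s, S s /\ norm (vsub x s) < d / 2.
have U'N x : U' x -> N x by move=> [s [Ss hs]]; exists s; split=> //; lra.
have NW x : N x -> W x by move=> [s [Ss hs]]; apply: (hd s) => //; lra.
have NU x : N x -> U x by move=> /NW/WU.
have oU' : is_open U'.
  move=> x [s [Ss hs]]; have [e [e0 he]] := is_open_ball _ s _ x hs.
  by exists e; split=> // y /he hy; exists s.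
have clN a : (forall eps, 0 < eps -> exists x, N x /\ norm (vsub x a) < eps) -> N a.
  move=> ha.
  (* Compactness of [S] turns almost admissible centres for [a] into an exact one. *)
  have [eta eta0|s [Ss hs]] := cptS (fun eta s => norm (vsub a s) <= d / 2 + eta).
    have [x [[s [Ss hs]] hx]] := ha eta eta0; exists s; split=> //.
    by have := norm_vsub_triangle _ a x s; rewrite (norm_vsubC _ a x); lra.
  exists s; split=> //; apply: Rnot_lt_le => lt.
  have [eta [z [[eta0 eta1] [Sz [hz hz']]]]] := hs ((norm (vsub a s) - d / 2) / 2) ltac:(lra).
  by have := norm_vsub_triangle _ a z s; lra.
have cptN : cluster_compact N.
  apply: (bounded_closed_cluster_compact _ _ (B + d / 2)) => // x [s [Ss hs]].
  rewrite -(vaddK _ s x); apply: Rle_trans (norm_triangle _ _ _) _.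
  by have := hB s Ss; lra.
have near_S eps : 0 < eps -> exists eta, 0 < eta /\
    forall x, N x -> V x < eta -> exists z, S z /\ norm (vsub x z) < eps.
  move=> eps0; apply: NNPP => no.
  (* Points far from [S] with ever smaller [V] would accumulate at a point of [N] where [V]
     vanishes, that is, at a point of [S]. *)
  have [eta eta0|a [Na ha]] := cptN (fun eta x =>
      V x < eta /\ ~ exists z, S z /\ norm (vsub x z) < eps).
    apply: NNPP => no'; apply: no; exists eta; split=> // x Nx Vx.
    by apply: NNPP => no; apply: no'; exists x.
  have Sa : S a.
    split; first exact: NU.
    case: (V0 a) => // Va; have Va2 : 0 < V a / 2 by lra.
    have [d' [d'0 hd']] := V_cont a (NU a Na) _ Va2.
    have [eta [x [[eta0 eta1] [_ [hx [Vx _]]]]]] := ha _ (Rmin_glb_lt _ _ _ d'0 Va2).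
    have := hd' x (Rlt_le_trans _ _ _ hx (Rmin_l _ _)).
    by have := Rmin_r d' (V a / 2); split_Rabs; lra.
  have [eta [x [_ [_ [hx [_ nz]]]]]] := ha eps eps0.
  by apply: nz; exists a.
have grad_nz x : N x -> dot (gradV x) (gradV x) = 0 -> V x = 0.
  move=> Nx g0; apply: NNPP => Vx; have Ux := NU x Nx.
  (* With [Df h = f x - f x0], the product [grad V . h] is the quadratic form itself, so a zero
     gradient forces [V x = 0]. *)
  have [h hh] := ontoW x (NW x Nx) Vx _ (hDf x Ux) (vsub (f x) (f x0)).
  apply: Vx; rewrite /V /Vfun.
  have : dot (gradV x) h = qform K (vsub (f x) (f x0)).
    rewrite (Vfun_grad _ _ _ _ _ _ _ _ h sK (hDf x Ux) (hgrad x Ux)) /qform dotC.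
    by apply: rsum_ext => i; rewrite hh.
  have := Cauchy_Schwarz _ (gradV x) h; rewrite {1}/norm g0 sqrt_0 Rmult_0_l.
  by have := Rabs_pos (dot (gradV x) h); split_Rabs; lra.
have grad_bound eta : 0 < eta -> exists m, 0 < m /\
    forall x, N x -> eta <= V x -> m <= dot (gradV x) (gradV x).
  move=> eta0; apply: NNPP => no.
  (* Ever smaller gradients where [eta <= V] would accumulate at a critical point with [V > 0]. *)
  have [m m0|a [Na ha]] := cptN (fun m x => eta <= V x /\ dot (gradV x) (gradV x) < m).
    apply: NNPP => no'; apply: no; exists m; split=> // x Nx Vx.
    by apply: Rnot_lt_le => lt; apply: no'; exists x.
  have g0 : dot (gradV a) (gradV a) = 0.
    case: (dot_ge0 _ (gradV a)) => // ga; have ga2 : 0 < dot (gradV a) (gradV a) / 2 by lra.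
    have [d' [d'0 hd']] := grad2_cont a (NU a Na) _ ga2.
    have [m [x [[m0 m1] [_ [hx [_ gx]]]]]] := ha _ (Rmin_glb_lt _ _ _ d'0 ga2).
    have := hd' x (Rlt_le_trans _ _ _ hx (Rmin_l _ _)).
    by have := Rmin_r d' (dot (gradV a) (gradV a) / 2); split_Rabs; lra.
  have Va := grad_nz a Na g0.
  have [d' [d'0 hd']] := V_cont a (NU a Na) eta eta0.
  have [m [x [_ [_ [hx [Vx _]]]]]] := ha d' d'0.
  by have := hd' x hx; rewrite Va; split_Rabs; lra.
(* Points of [N] with [V < eta] lie in the open tube [U']. Taking [c = eta / 2] leaves a strict
   margin for limits of points with [V <= c]. *)
have [eta [eta0 heta]] := near_S (d / 2) ltac:(lra).
have U'U x : U' x -> U x by move=> /U'N/NU.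
have neg x : U' x -> dot (gradV x) (Y x) <= 0.
  by move=> /U'U Ux; rewrite dotY //; have := dot_ge0 _ (gradV x); lra.
have gradU' x : U' x -> is_grad V x (gradV x) by move=> /U'U; exact: hgrad.
have contU' x : U' x -> cont_at V x by move=> /U'U; exact: V_cont.
exists (eta / 2); split; first by lra.
exists U'; split=> //; split; first by move=> x /U'N/NW.
split.
  by move=> x Ux Vx; exists x; rewrite norm_vsubxx; split=> //; lra.
rewrite -/Y; move=> Y' Sc; rewrite {}/Y'.
have stay phi T : solution_on U' Y phi T -> Sc (phi 0) -> forall t, 0 <= t < T -> Sc (phi t).
  move=> sol [_ [_ Vp]] t [t0 tT]; split; first exact: (proj1 sol).
  split; first exact: V0.
  apply: Rle_trans Vp.
  by apply: (solution_nonincreasing _ _ _ _ _ _ _ sol gradU' contU') => //; lra.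
split; last split.
- move=> p [U'p [_ Vp]].
  (* [gL.1] extends coordinate [i] of [Y] from [N] to the whole space, with Lipschitz constant
     [gL.2]; the sum of these constants serves all coordinates. *)
  have exF i : exists gL : (vec n -> R) * R, 0 <= gL.2 /\ (forall x, N x -> gL.1 x = Y x i) /\
      forall x y, Rabs (gL.1 x - gL.1 y) <= gL.2 * norm (vsub x y).
    have [a /NU Ua|L [L0 hL]] := cluster_compact_lipschitz _ _ (fun x => Y x i) cptN.
      exact: Y_lip.
    have [|g [hg1 hg2]] := lipschitz_extension _ N _ L _ L0 hL; first by exists p; exact: U'N.
    by exists (g, L).
  pose gL i := proj1_sig (constructive_indefinite_description _ (exF i)).
  have hgL i : 0 <= (gL i).2 /\ (forall x, N x -> (gL i).1 x = Y x i) /\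
      forall x y, Rabs ((gL i).1 x - (gL i).1 y) <= (gL i).2 * norm (vsub x y).
    exact: proj2_sig (constructive_indefinite_description _ (exF i)).
  pose F x : vec n := fun i => (gL i).1 x.
  have FY x : N x -> F x = Y x.
    by move=> Nx; apply: functional_extensionality => i; exact: (proj1 (proj2 (hgL i))).
  have L0 : 0 <= rsum n (fun i => (gL i).2) by apply: rsum_ge0 => i; exact: (proj1 (hgL i)).
  have [x y i|phi [phi0 dphi]] := lipschitz_global_flow _ F _ p L0.
    apply: Rle_trans (proj2 (proj2 (hgL i)) x y) _.
    apply: Rmult_le_compat_r; first exact: norm_ge0.
    by apply: (rsum_ge_term _ (fun j => (gL j).2)) => j; exact: (proj1 (hgL j)).
  exists phi; split=> // T T0.
  have cphi t : 0 <= t -> forall eps, 0 < eps -> exists e, 0 < e /\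
      forall s, Rabs (s - t) < e -> norm (vsub (phi s) (phi t)) < eps.
    move=> t0; apply: curve_continuous => i; apply: derivable_continuous_pt.
    by exists (F (phi t) i); exact: dphi.
  have sol T' : (forall t, 0 <= t < T' -> U' (phi t)) -> solution_on U' Y phi T'.
    move=> inU'; split=> //; split.
      by move=> t ht i; rewrite -FY; [apply: dphi; lra|apply/U'N/inU'; lra].
    move=> eps eps0; have [e [e0 he]] := cphi 0 (Rle_refl 0) eps eps0.
    by exists e; split=> // s hs; apply: he; rewrite Rminus_0_r Rabs_pos_eq; lra.
  apply: (sol T) => t1 [t10 _] {T T0}; apply: NNPP => out.
  (* If the curve were outside [U'] at [t1], the times up to which it stays in [U'] would be bounded
     by [t1] and have a supremum [T]. *)
  pose E t := 0 <= t /\ forall s, 0 <= s <= t -> U' (phi s).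
  have [||T [ubT lubT]] := completeness E.
  + exists t1 => t [t0 ht]; apply: Rnot_lt_le => lt; apply: out; apply: ht; lra.
  + by exists 0; split=> [|s hs]; [lra|have -> : s = 0 by lra]; rewrite phi0.
  have T0 : 0 <= T.
    by apply: ubT; split=> [|s hs]; [lra|have -> : s = 0 by lra]; rewrite phi0.
  have before t : 0 <= t < T -> U' (phi t).
    move=> [t0 tT]; apply: NNPP => ot.
    have : T <= t; last by lra.
    by apply: lubT => s [s0 hs]; apply: Rnot_lt_le => lt; apply: ot; apply: hs; lra.
  have Scb t : 0 <= t < T -> Sc (phi t).
    by apply: stay; [exact: sol|rewrite phi0].
  (* At time [T] closedness of [N] and continuity of [V] give [N] and [V < eta], hence membership in
     [U']; openness then carries the curve past [T]. *)
  have [NT VT] : N (phi T) /\ V (phi T) < eta.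
    case: T0 => [T0|<-]; last first.
      by rewrite phi0; split; [exact: U'N|apply: (Rle_lt_trans _ _ _ Vp); lra].
    have approach e : 0 < e -> exists t, 0 <= t < T /\ Rabs (t - T) < e.
      move=> e0; have m0 : 0 < Rmin (e / 2) T by apply: Rmin_glb_lt; lra.
      have := Rmin_l (e / 2) T; have := Rmin_r (e / 2) T => h1 h2.
      by exists (T - Rmin (e / 2) T); split; [lra|split_Rabs; lra].
    have NT : N (phi T).
      apply: clN => eps eps0; have [e [e0 he]] := cphi T (Rlt_le _ _ T0) eps eps0.
      have [t [tT te]] := approach e e0; exists (phi t); split; last exact: he.
      exact/U'N/before.
    split=> //; apply: Rnot_le_lt => VT.
    have [d' [d'0 hd']] := V_cont _ (NU _ NT) (eta / 2) ltac:(lra).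
    have [e [e0 he]] := cphi T (Rlt_le _ _ T0) d' d'0.
    have [t [tT te]] := approach e e0; have := hd' _ (he t te).
    have [_ [_ Vt]] := Scb t tT.
    by rewrite -/V in Vt; split_Rabs; lra.
  have [rho [rho0 hrho]] := oU' _ (heta _ NT VT).
  have [e [e0 he]] := cphi T T0 rho rho0.
  have : T + e / 2 <= T; last by lra.
  apply: ubT; split=> [|s hs]; first by lra.
  case: (Rlt_le_dec s T) => sT; first by apply: before; lra.
  by apply/hrho/he; rewrite Rabs_pos_eq; lra.
- by move=> phi T _; exact: stay.
move=> phi sol Sc0 eps eps0.
have [eta' [eta'0 heta']] := near_S eps eps0.
have [m [m0 hm]] := grad_bound eta' eta'0.
have c0 : 0 <= eta / 2 / m by apply: Rdiv_le_0_compat; lra.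
(* The clock starts at [1], as the decay estimate needs a positive time. If [V] were still at least
   [eta'] at time [t], decay at rate [m] since time [1] would bring it from at most [eta / 2] below
   [0]. *)
exists (1 + (eta / 2 / m + 1)) => t ht.
have t2 : 0 < t + 1 by lra.
have solt := sol (t + 1) t2.
have inN s : 0 <= s <= t -> N (phi s) by move=> hs; apply/U'N/(proj1 solt); lra.
apply: heta'; first by apply: inN; lra.
apply: Rnot_le_lt => Vt.
have Vs s : 0 <= s <= t -> eta' <= V (phi s).
  move=> hs; apply: Rle_trans Vt _.
  by apply: (solution_nonincreasing _ _ _ _ _ _ _ solt gradU' contU') => //; lra.
have [_ [_ V1]] := stay _ _ solt Sc0 1 ltac:(lra).
have : V (phi t) <= V (phi 1) - m * (t - 1).
  apply: (solution_decay_rate _ _ _ _ _ _ _ solt gradU'); try lra.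
  move=> u hu; rewrite dotY; last by apply/NU/inN; lra.
  by have := hm (phi u) (inN u ltac:(lra)) (Vs u ltac:(lra)); lra.
have : m * (eta / 2 / m + 1) <= m * (t - 1) by apply: Rmult_le_compat_l; lra.
have -> : m * (eta / 2 / m + 1) = eta / 2 + m by field; lra.
by rewrite -/V in V1; have := V0 (phi t); lra.
Qed.
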